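(* Let $k > \ell \ge 0$ be integers and let $G$ be a $(k,\ell)$-stable graph with $|V(G)| = n$, where $n \ge k$. Then $$\alpha(G) \le \left\lfloor \frac{n-k+1}{2} \right\rfloor + \ell.$$
   Context: All graphs are finite, undirected, and simple. $\alpha(G)$ denotes the independence number of $G$ (with $\alpha = 0$ for the graph with no vertices). For vertices $v_1,\ldots,v_k$ of $G$, $G \setminus \{v_1,\ldots,v_k\}$ denotes the induced subgraph of $G$ on $V(G)\setminus\{v_1,\ldots,v_k\}$. For integers $k > \ell \ge 0$, a graph $G$ is called $(k,\ell)$-stable if for every $k$ vertices $v_1,\ldots,v_k$ of $G$, $\alpha(G\setminus\{v_1,\ldots,v_k\}) \ge \alpha(G) - \ell$. *)

(* Defs.v *)
From mathcomp Require Import all_boot.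
Set Implicit Arguments.
Unset Strict Implicit.
Unset Printing Implicit Defensive.

Record sgraph := SGraph {
  vertex :> finType;
  adj : rel vertex;
  adj_sym : symmetric adj;
  adj_irr : irreflexive adj }.

Section Induced.
Variables (G : sgraph) (A : {set G}).

Definition induced_adj : rel {x : G | x \in A} :=
  fun x y => adj (val x) (val y).

Lemma induced_adj_sym : symmetric induced_adj.
Proof. by move=> x y; rewrite /induced_adj adj_sym. Qed.

Lemma induced_adj_irr : irreflexive induced_adj.
Proof. by move=> x; rewrite /induced_adj adj_irr. Qed.

Definition induced : sgraph := SGraph induced_adj_sym induced_adj_irr.

End Induced.

Definition del_vertices (G : sgraph) (S : {set G}) : sgraph := induced (~: S).

Definition independent (G : sgraph) (A : {set G}) : bool :=
  [forall x in A, forall y in A, ~~ adj x y].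

(* set0 is always independent, so the maximum is over a nonempty family and
   alpha is 0 on the graph with no vertices. *)
Definition alpha (G : sgraph) : nat :=
  \max_(A : {set G} | independent A) #|A|.

(* The k vertices are distinct, given as the set S. Truncated subtraction is
   harmless here: if alpha G < l, the inequality holds either way. *)
Definition stable (k l : nat) (G : sgraph) : Prop :=
  forall S : {set G}, #|S| = k -> alpha G - l <= alpha (del_vertices S).

(* Main.v *)
(* Induct on l. Either some (k-1)-set T has alpha(G \ T) <= alpha(G) - l, and
   then no vertex of G \ T is in all of its maximum independent sets, which
   forces 2 alpha(G \ T) <= n - k + 1; or G is (k-1,l-1)-stable.  For l = 0 any
   (k-1)-set T will do. *)
Require Import Defs.
From mathcomp Require Import all_boot.
From mathcomp Require Import zify.

Set Implicit Arguments.
Unset Strict Implicit.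
Unset Printing Implicit Defensive.

Lemma independentP (G : sgraph) (A : {set G}) :
  reflect {in A &, forall x y, ~~ adj x y} (independent A).
Proof.
apply: (iffP forall_inP) => [indA x y xA yA | indA x xA].
  by move/forall_inP: (indA x xA); apply.
by apply/forall_inP => y; apply: indA.
Qed.

(** Together with [alpha_del_witness], this trades [alpha (del_vertices T)] for subsets of [G], so
    later unions and intersections avoid the subtype. *)
Lemma leq_alpha_del (G : sgraph) (T A : {set G}) :
  independent A -> A \subset ~: T -> #|A| <= alpha (del_vertices T).
Proof.
move=> /independentP indA sAT.
pose B : {set del_vertices T} := [set x | val x \in A].
have <- : #|B| = #|A|.
  rewrite -(card_imset _ val_inj); congr #|pred_of_set _|.
  apply/setP => x; apply/imsetP/idP => [[y + ->] | xA]; first by rewrite inE.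
  by exists (Sub x (subsetP sAT x xA)); rewrite ?inE ?SubK.
apply: (bigmax_sup B) => //.
by apply/independentP => x y; rewrite !inE; apply: indA.
Qed.

Lemma alpha_del_witness (G : sgraph) (T : {set G}) :
  exists A : {set G},
    [/\ independent A, A \subset ~: T & #|A| = alpha (del_vertices T)].
Proof.
have ind0 : independent (set0 : {set del_vertices T}).
  by apply/independentP => x y; rewrite inE.
rewrite /alpha (bigmax_eq_arg set0) //.
case: arg_maxnP => // B /independentP indB _.
exists [set val x | x in B]; split; last by rewrite card_imset //; apply: val_inj.
  by apply/independentP => _ _ /imsetP[x xB ->] /imsetP[y yB ->]; apply: indB.
by apply/subsetP => _ /imsetP[x _ ->]; apply: (valP x).
Qed.

Section NoCommonVertex.

Variables (G : sgraph) (W : {set G}) (a : nat).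
Hypothesis ind_le : forall A : {set G}, independent A -> A \subset W -> #|A| <= a.
Hypothesis ind_avoid : forall v, v \in W ->
  exists S : {set G}, [/\ independent S, S \subset W, v \notin S & a <= #|S|].

(* A and B stand for the intersection and the union of a family of maximum
   independent sets of W.  When such a set S joins the family, the independent
   set (S :&: B) :|: A is no larger than S, so B grows at least as much as A
   shrinks. *)
Lemma leq_double_ind_inter_union (A B : {set G}) :
  A \subset B -> B \subset W -> {in A & B, forall x y, ~~ adj x y} ->
  a.*2 <= #|A| + #|B| -> a.*2 <= #|W|.
Proof.
have [m] := ubnP #|A|; elim: m A B => // m IHm A B ltAm sAB sBW noedge leaAB.
have [A0 | [v vA]] := set_0Vmem A.
  by move: leaAB; rewrite A0 cards0 => /leq_trans -> //; apply: subset_leq_card.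
have [S [/independentP indS sSW vS leaS]] := ind_avoid (subsetP sBW v (subsetP sAB v vA)).
have le_swap : #|S :&: B :|: A| <= a.
  apply: ind_le.
    apply/independentP => x y /setUP[/setIP[xS xB] | xA] /setUP[/setIP[yS yB] | yA].
    - exact: indS.
    - by rewrite adj_sym noedge.
    - exact: noedge.
    - by rewrite noedge // (subsetP sAB).
  by rewrite subUset (subset_trans (subsetIr _ _) sBW) (subset_trans sAB sBW).
have capE : (S :&: B) :&: A = A :&: S.
  by rewrite -setIA (setIidPr sAB) setIC.
have ltAS : #|A :&: S| < #|A|.
  apply: proper_card; apply/properP; split; first exact: subsetIl.
  by exists v; rewrite // inE (negPf vS) andbF.
apply: (IHm (A :&: S) (B :|: S)).
- lia.
- by rewrite (subset_trans (subsetIr _ _)) ?subsetUr.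
- by rewrite subUset sBW.
- move=> x y /setIP[xA xS] /setUP[yB | yS]; first exact: noedge.
  exact: indS.
(* Adding the two identities gives [#|A :&: S| + #|B :|: S| = #|A| + #|B| + #|S| - #|S :&: B :|:
   A|], and the last two terms contribute at least [a - a]. *)
- have := cardsUI (S :&: B) A; have := cardsUI B S.
  rewrite capE (setIC B S); lia.
Qed.

(** The family starts as a single set [S], its own intersection and union; a vertex of [W] is needed
    to obtain it. *)
Lemma leq_double_ind : W != set0 -> a.*2 <= #|W|.
Proof.
case/set0Pn => v /ind_avoid[S [/independentP indS sSW _ leaS]].
by apply: (@leq_double_ind_inter_union S S) => //; rewrite -addnn leq_add.
Qed.

End NoCommonVertex.

(** For [v] outside [T], stability applied to the [k.+1] vertices of [v |: T] yields a large
    independent set avoiding both [v] and [T]. *)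
Lemma stable_critical_bound (G : sgraph) (k l : nat) (T : {set G}) :
  stable k.+1 l G -> k < #|G| -> #|T| = k ->
  alpha (del_vertices T) <= alpha G - l -> (alpha G - l).*2 <= #|G| - k.
Proof.
move=> stG ltkG cardT leT.
have cardW : #|~: T| = #|G| - k by rewrite cardsCs setCK cardT.
rewrite -cardW; apply: leq_double_ind => [A indA sAT | v |].
- exact: leq_trans (leq_alpha_del indA sAT) leT.
- rewrite inE => vT.
  have [S [indS sST cardS]] := alpha_del_witness (v |: T).
  exists S; split=> //.
  + by apply: subset_trans sST _; rewrite setCS subsetUr.
  + by apply/negP => /(subsetP sST); rewrite !inE eqxx.
  + by rewrite cardS; apply: stG; rewrite cardsU1 vT cardT.
- by rewrite -card_gt0 cardW subn_gt0.
Qed.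

Lemma alpha_del_le (G : sgraph) (T : {set G}) : alpha (del_vertices T) <= alpha G.
Proof.
have [A [indA _ <-]] := alpha_del_witness T.
exact: (bigmax_sup A).
Qed.

Theorem theorem1 (k l n : nat) (G : sgraph)
  (hlk : l < k) (hG : stable k l G) (hn : #|G| = n) (hkn : k <= n) :
  alpha G <= (n - k + 1) %/ 2 + l.
Proof.
subst n; elim: l k hlk hG hkn => [|l IHl] [|k] // ltlk stG ltkG.
  have [T cardT] : exists T : {set G}, #|T| = k.
    have : 0 < #|[set T : {set G} | #|T| == k]| by rewrite card_draws bin_gt0 ltnW.
    by case/card_gt0P => T; rewrite inE => /eqP; exists T.
  have := stable_critical_bound stG ltkG cardT.
  by rewrite subn0 alpha_del_le => /(_ isT); lia.
have [/existsP[T /andP[/eqP cardT leT]] | noT] :=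
    boolP [exists T : {set G}, (#|T| == k) && (alpha (del_vertices T) <= alpha G - l.+1)].
  by have := stable_critical_bound stG ltkG cardT leT; lia.
(* Every [k]-set now leaves more than [alpha G - l.+1], hence at least [alpha G - l]. *)
have stG' : stable k l G.
  move=> T cardT; move/existsPn/(_ T): noT; rewrite cardT eqxx /=; lia.
(* Passing from [k.+1] to [k] raises the quotient by at most one, which the drop from [l.+1] to [l]
   offsets. *)
by have := IHl k ltlk stG' (ltnW ltkG); lia.
Qed.
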